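(* Let $k$ be an algebraically closed field of characteristic $p\ge 5$. Let $s=\lceil\frac p3\rceil$ and $r=p-s$. Consider the affine plane curve $C=\mathcal Z(f)\subset\mathbb A^2_k$, of degree $2s<p$, defined by $$f(x,y)=y^2+2(x^s+x^r)y+x^{2s}.$$ Then the polynomial $1$-form $$\omega=2U\,d(y+x^s+x^r)-(y+x^s+x^r)\,dU,\qquad U=2+x^{2r-p},$$ leaves $C$ invariant and $\omega(0)\neq 0$.
   Context: A polynomial $1$-form $\omega$ on $\mathbb A^2_k$ leaves a curve $C=\mathcal Z(f)$ invariant if $\omega\wedge\frac{df}{f}$ is a regular $2$-form, i.e. $f$ divides the coefficient of $\omega\wedge df$ in $k[x,y]$. Here $\omega(0)$ is the value of $\omega$ at the origin $(0,0)$. *)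

(* Defs.v *)
From mathcomp Require Import all_boot all_order all_algebra.
From mathcomp Require Export mpoly.
Set Implicit Arguments.
Unset Strict Implicit.
Unset Printing Implicit Defensive.
Import GRing.Theory.
Local Open Scope ring_scope.

(* k[x,y] is {mpoly k[2]}, with x the variable of index 0 and y that of
   index 1. *)

(* The row vector (a, b) stands for the 1-form a dx + b dy. *)
Definition form1 (k : comNzRingType) := 'rV[{mpoly k[2]}]_2.

Definition extd (k : comNzRingType) (g : {mpoly k[2]}) : form1 k :=
  \row_i mderiv i g.

(* The coefficient of dx /\ dy in w1 /\ w2. *)
Definition wedge (k : comNzRingType) (w1 w2 : form1 k) : {mpoly k[2]} :=
  w1 0 0 * w2 0 1 - w1 0 1 * w2 0 0.

Definition leaves_invariant (k : comNzRingType) (w : form1 k)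
    (f : {mpoly k[2]}) : Prop :=
  exists g : {mpoly k[2]}, wedge w (extd f) = g * f.

Definition form1_at (k : comNzRingType) (w : form1 k) (v : 'I_2 -> k) :
    'rV[k]_2 :=
  map_mx (meval v) w.

Section CurveAndForm.
Variables (k : comNzRingType) (p s r : nat).

Let x : {mpoly k[2]} := 'X_0.
Let y : {mpoly k[2]} := 'X_1.

Definition curve_poly : {mpoly k[2]} :=
  y ^+ 2 + 2 * (x ^+ s + x ^+ r) * y + x ^+ (2 * s).

(* The exponent is a truncated subtraction; it is the true 2r - p as soon as
   r = p - s and 2s <= p, since then 2r - p = p - 2s. *)
Definition U_poly : {mpoly k[2]} := 2 + x ^+ (2 * r - p).

Definition omega : form1 k :=
  (2 * U_poly) *: extd (y + x ^+ s + x ^+ r)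
  - (y + x ^+ s + x ^+ r) *: extd U_poly.

End CurveAndForm.

Arguments curve_poly : clear implicits.
Arguments U_poly : clear implicits.
Arguments omega : clear implicits.

(* Main.v *)
Require Import Defs.
From mathcomp Require Import all_boot all_order all_algebra.
From mathcomp Require Import mpoly.
From mathcomp Require Import zify ring lra.
Import Order.TTheory GRing.Theory Num.Theory.
Local Open Scope ring_scope.

(** Put z = y + x^s + x^r.  Since p = r + s, completing the square gives
    f = z^2 - (x^s + x^r)^2 + x^(2s) = z^2 - x^p U.  In characteristic p the
    factor x^p has zero differential, so df = 2 z dz - x^p dU and
    (2 U dz - z dU) /\ df = 2 (z^2 - x^p U) dz /\ dU.  At the origin z = 0 and
    U = 2, so that omega(0) has dy-coefficient 4. *)

Lemma ceil_div3_bounds (n s : nat) :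
  s = `|Num.ceil (n%:R / 3%:R : rat)|%N -> (n <= 3 * s < n + 3)%N.
Proof.
move=> sE; have /andP[lo hi] := ceil_itv (n%:R / 3%:R : rat).
have c_ge0 : 0 <= Num.ceil (n%:R / 3%:R : rat).
  by rewrite ceil_ge0 (lt_le_trans (ltrN10 _)) // divr_ge0 ?ler0n.
rewrite -(gez0_abs c_ge0) -sE in lo hi.
rewrite ler_pdivrMr ?ltr0n // in hi.
rewrite ltr_pdivlMr ?ltr0n // intrD in lo.
have hi' : (n%:R : rat) <= (3 * s)%:R by rewrite natrM mulrC.
have lo' : ((3 * s)%:R : rat) < (n + 3)%:R.
  by rewrite natrD natrM; move: lo; rewrite -pmulrn; lra.
by rewrite ler_nat in hi'; rewrite ltr_nat in lo'; rewrite hi' lo'.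
Qed.

(** A prime [p >= 5] is not a multiple of 3, so [p <= 3 * s] is strict; and [3 * s <= p + 2] yields
    [2 * s < p] because [p > 4]. *)
Lemma prime_ceil_div3_bounds (p s : nat) :
  prime p -> (5 <= p)%N -> s = `|Num.ceil (p%:R / 3%:R : rat)|%N ->
  (p < 3 * s)%N /\ (2 * s < p)%N.
Proof.
move=> p_prime hp /ceil_div3_bounds bnd.
have p_n3 : p != (3 * s)%N.
  apply/eqP=> p3; have /(prime_nt_dvdP p_prime) : (3 %| p)%N by rewrite p3 dvdn_mulr.
  by move=> /(_ isT) p3'; rewrite -p3' in hp.
split; lia.
Qed.

Lemma mderiv_exp (n : nat) (R : comNzRingType) (i : 'I_n) (q : {mpoly R[n]}) m :
  (q ^+ m)^`M(i) = q ^+ m.-1 * q^`M(i) *+ m.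
Proof.
elim: m => [|m IHm]; first by rewrite expr0 mulr0n -mpolyC1 mderivC.
rewrite exprS mderivM IHm /= mulrS [in LHS]mulrC; congr (_ + _).
(* The truncated [m.-1] forces the split: [q * q ^+ m.-1] is [q ^+ m] only for [m > 0], while for
   [m = 0] the multiplicity 0 kills the term. *)
by case: m {IHm} => [|m]; rewrite ?mulr0n ?mulr0 // mulrnAr mulrA -exprS.
Qed.

Lemma mderiv_pchar_exp (n : nat) (R : comNzRingType) (p : nat) (i : 'I_n)
    (q : {mpoly R[n]}) :
  p \in [pchar R] -> (q ^+ p)^`M(i) = 0.
Proof.
by move=> /pcharf0 p0; rewrite mderiv_exp -scaler_nat p0 scale0r.
Qed.

Lemma wedge_square_sub (R : comNzRingType) (z u q : {mpoly R[2]}) :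
  (forall i, q^`M(i) = 0) ->
  wedge ((2 * u) *: extd z - z *: extd u) (extd (z ^+ 2 - q * u)) =
  2 * (z^`M(0) * u^`M(1) - z^`M(1) * u^`M(0)) * (z ^+ 2 - q * u).
Proof.
move=> dq; rewrite /wedge /extd !mxE !mderivB !mderivM !dq.
ring.
Qed.

Lemma curve_polyE (R : comNzRingType) (p s r : nat) :
  p = (s + r)%N -> (s <= r)%N ->
  curve_poly R s r =
  ('X_1 + 'X_0 ^+ s + 'X_0 ^+ r) ^+ 2 - 'X_0 ^+ p * U_poly R p r.
Proof.
(* With [r = s + t] the truncated exponent [2 * r - p] becomes [t], leaving an identity between
   powers of x. *)
move=> -> /subnKC <-; move: (r - s)%N => t.
have -> : U_poly R (s + (s + t)) (s + t) = 2 + 'X_0 ^+ t.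
  by rewrite /U_poly; congr (_ + _ ^+ _); lia.
rewrite /curve_poly mulnC exprM !exprD.
ring.
Qed.

(** [msize] is the total degree plus one. The bound on [r] keeps x^r y within degree 2s, and x^(2s)
    cannot cancel, being the only term free of y. *)
Lemma msize_curve_poly (R : comNzRingType) (s r : nat) :
  (0 < s)%N -> (r < 2 * s)%N -> msize (curve_poly R s r) = (2 * s).+1.
Proof.
move=> s_gt0 lt_r2s.
pose m a b : 'X_{1..2} := (U_(0%R) *+ a + U_(1%R) *+ b)%MM.
have XE a b : 'X_0 ^+ a * 'X_1 ^+ b = 'X_[m a b] :> {mpoly R[2]}.
  by rewrite mpolyXD !mpolyXn.
have fE : curve_poly R s r =
    'X_[m 0 2] + ('X_[m s 1] + 'X_[m r 1]) *+ 2 + 'X_[m (2 * s) 0]%N.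
  rewrite -!XE /curve_poly; ring.
have mdegm a b : mdeg (m a b) = (a + b)%N.
  by rewrite mdegD !mdegMn !mdeg1 !mul1n.
have m1 a b : m a b 1 = b.
  by rewrite mnmDE !mulmnE !mnm1E /= mul0n mul1n.
have sizeX a b : (a + b <= 2 * s)%N -> (msize 'X_[R, m a b] <= (2 * s).+1)%N.
  by rewrite msizeX mdegm.
apply/eqP; rewrite eqn_leq; apply/andP; split.
  rewrite fE mulr2n.
  repeat (apply: leq_trans (msizeD_le _ _) _; rewrite geq_max; apply/andP; split);
    apply: sizeX; lia.
have neq a b : (0 < b)%N -> (m a b == m (2 * s)%N 0) = false.
  by move=> b_gt0; apply/eqP=> /(congr1 (fun t : 'X_{1..2} => t 1)); rewrite !m1; lia.
rewrite -[X in (X.+1 <= _)%N]addn0 -mdegm; apply: msize_mdeg_lt.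
rewrite mcoeff_msupp fE !mcoeffD !mcoeffX eqxx !neq //.
by rewrite !add0r oner_neq0.
Qed.

Lemma omega_at_origin (R : comNzRingType) (p s r : nat) :
  (0 < s)%N -> (0 < r)%N -> (p < 2 * r)%N ->
  form1_at (omega R p s r) (fun _ => 0) 0 1 = 4.
Proof.
move=> s_gt0 r_gt0 lt_p2r.
have X0n n : (0 < n)%N -> meval (fun _ : 'I_2 => 0) ('X_0 ^+ n) = 0 :> R.
  by move=> n_gt0; rewrite rmorphXn /= mevalXU expr0n eqn0Ngt n_gt0.
have z0 : meval (fun _ => 0) ('X_1 + 'X_0 ^+ s + 'X_0 ^+ r : {mpoly R[2]}) = 0.
  by rewrite !mevalD mevalXU !X0n // !addr0.
(* As [p < 2 * r], the power of x in U has positive exponent and vanishes at the origin. *)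
have U0 : meval (fun _ => 0) (U_poly R p r) = 2.
  by rewrite /U_poly mevalD X0n ?subn_gt0 // addr0 rmorph_nat.
have dX1 n : ('X_0 ^+ n : {mpoly R[2]})^`M(1) = 0.
  by rewrite mderiv_exp mderivX mnm1E /= scale0r mulr0 mul0rn.
rewrite /form1_at /omega /extd !mxE mevalB !mevalM z0 U0 rmorph_nat mul0r subr0.
rewrite !mderivD !dX1 !addr0 mderivX mnm1E eqxx scale1r.
(* The derivative of y in y appears as the monomial of exponent [U_(1) - U_(1)], that is 1. *)
rewrite -[X in (X - _)%MM]add0m addmK mpolyX0 meval1; ring.
Qed.

Theorem proposition3p4 (k : closedFieldType) (p : nat)
    (hchar : p \in [pchar k]) (hp : (5 <= p)%N)
    (s r : nat)
    (hs : s = `|Num.ceil (p%:R / 3%:R : rat)|%N)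
    (hr : r = (p - s)%N) :
  [/\ msize (curve_poly k s r) = (2 * s).+1,
      (2 * s < p)%N,
      leaves_invariant (omega k p s r) (curve_poly k s r)
    & form1_at (omega k p s r) (fun _ : 'I_2 => 0) <> 0].
Proof.
have p_prime : prime p := pcharf_prime hchar.
have [lt_p3s lt_2sp] := prime_ceil_div3_bounds p s p_prime hp hs.
split=> //.
(* Here [r < 2 * s] is [p < 3 * s]. *)
- by apply: msize_curve_poly; lia.
- have pE : p = (s + r)%N by lia.
  have le_sr : (s <= r)%N by lia.
  rewrite (curve_polyE k p s r pE le_sr) /leaves_invariant.
  (* Unification supplies the cofactor, twice the coefficient of dz /\ dU; it remains that x^p has
     zero partial derivatives. *)
  eexists; apply: wedge_square_sub => i.
  exact: mderiv_pchar_exp.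
- move=> /(congr1 (fun w : 'rV_2 => w 0 1)).
  rewrite omega_at_origin ?mxE; [|lia..].
  (* 4 is the square of 2, which is nonzero in [k] since [p > 2]. *)
  apply/eqP; rewrite (natrX k 2 2) expf_eq0 /= -(dvdn_pcharf hchar).
  by rewrite gtnNdvd //; apply: leq_trans hp.
Qed.
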